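(* Let $n\ge 1$ be an integer, let $a_0,a_1,\ldots,a_n$ be nonnegative integers, and put $a=a_1+a_2+\cdots+a_n$. Let $i_1,\ldots,i_m$ and $j_1,\ldots,j_\nu$ be (altogether) distinct integers with $0=i_1<\cdots<i_m<n$ and $0<j_1<\cdots<j_\nu\le n$, let $p_1,\ldots,p_\nu$ be positive integers with $\sum_{i=1}^{\nu}p_i=m$, and put $I_0=\{i_1,\ldots,i_m\}$. Then $$\mathop{\mathrm{CT}}_{\mathbf{x}}\frac{x_{j_1}^{p_1}\cdots x_{j_\nu}^{p_\nu}}{x_{i_1}x_{i_2}\cdots x_{i_m}}\prod_{0\le i\ne j\le n}\left(1-\frac{x_i}{x_j}\right)^{a_i}=\frac{(a_0+a_1+\cdots+a_n)!}{a_0!\,a_1!\cdots a_n!}\sum_{\varnothing\neq T\subseteq I_0}(-1)^{d}\frac{\sigma(T)}{1+a+a_0-\sigma(T)},$$ where, for each nonempty $T\subseteq I_0$, $d=|T|$ and $\sigma(T)=\sum_{t\in T}a_t$.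
   Context: $\mathop{\mathrm{CT}}_{\mathbf{x}}F(\mathbf{x})$ denotes the constant term of the Laurent polynomial $F$ in the variables $\mathbf{x}=(x_0,\ldots,x_n)$. The product is over all ordered pairs $(i,j)$ with $0\le i,j\le n$, $i\ne j$. *)

(* Defs.v *)
From HB Require Import structures.
From mathcomp Require Import all_boot all_order all_algebra.
From mathcomp Require Import fraction.
From mathcomp Require Import mpoly.
From mathcomp Require Import boolp.

Set Implicit Arguments.
Unset Strict Implicit.
Unset Printing Implicit Defensive.

Import GRing.Theory.
Local Open Scope ring_scope.

(* Laurent polynomials in k variables over the rationals are the elements
   p / x^u of the field of rational functions, with p a polynomial and x^u a
   monomial. *)
Definition ratfun (k : nat) := {fraction {mpoly rat[k]}}.

Definition xvar (k : nat) (i : 'I_k) : ratfun k := tofrac ('X_i : {mpoly rat[k]}).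

Definition laurent_repr (k : nat) (F : ratfun k)
    (pu : {mpoly rat[k]} * 'X_{1..k}) : bool :=
  F == tofrac pu.1 / tofrac ('X_[pu.2] : {mpoly rat[k]}).

Definition laurent (k : nat) (F : ratfun k) : Prop :=
  exists pu, laurent_repr F pu.

(* The constant term of p / x^u is the coefficient of x^u in p; this does not
   depend on the representation (lemma CT_eq). CT F = 0 by convention when F is
   not a Laurent polynomial. *)
Definition CT (k : nat) (F : ratfun k) : rat :=
  if pselect (laurent F) is left FL
  then let pu := xchoose FL in mcoeff pu.2 pu.1
  else 0.

Lemma CT_eq (k : nat) (p : {mpoly rat[k]}) (u : 'X_{1..k}) :
  CT (tofrac p / tofrac ('X_[u] : {mpoly rat[k]}) : ratfun k) = mcoeff u p.
Proof.
have nzX (v : 'X_{1..k}) : tofrac ('X_[v] : {mpoly rat[k]}) != 0.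
  rewrite tofrac_eq0; apply/negP => /eqP/(congr1 (mcoeff v)).
  by rewrite mcoeffX eqxx mcoeff0 => /eqP; rewrite oner_eq0.
rewrite /CT; case: pselect => [FL|[]]; last by exists (p, u); exact: eqxx.
have := xchooseP FL; case: (xchoose FL) => q v.
rewrite /laurent_repr /= eqr_div ?nzX // -!tofracM tofrac_eq => /eqP pq.
by rewrite -(mcoeffMX q u v) -pq addmC mcoeffMX.
Qed.

(* Main.v *)
Require Import Defs.
From HB Require Import structures.
From mathcomp Require Import all_boot all_order all_algebra.
From mathcomp Require Import fraction.
From mathcomp Require Import mpoly.
From mathcomp Require Import ring.

Set Implicit Arguments.
Unset Strict Implicit.
Unset Printing Implicit Defensive.

Import GRing.Theory Num.Theory.
Local Open Scope ring_scope.

(** The Dyson product is handled by a functional form of the identity that can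
be proved by induction in the manner of Good.  For a set [S] of indices write
[D_S] for the product of [(1 - x_k / x_l)^(a_k)] over ordered pairs of distinct
elements of [S], [A] for the sum of [a] over [S] and [sigma T] for the sum of
[a] over [T].  If [g] is homogeneous of degree [#|S|], then the constant term of
[g D_S / prod_(k in S) x_k] is
  sum over T in S of  (-1)^|T| w(T) g(1_(S - T)),
  w(T) = (A + 1)! / (prod a_k!) / (1 + A - sigma T),
where [1_(S - T)] is the point with coordinates 0 on [T] and 1 on [S - T]
([mcoeff_dyson], stated with denominators cleared).  Working with all
homogeneous [g] instead of the given monomial is what makes the induction close.

The claim is clear for empty [S].  If [S] is nonempty and all [a_k] are
positive, Lagrange interpolation at the points [x_k] ([lagrange_at0])
gives [D_S(a) = sum_k D_S(a - e_k)] ([dyson_recursion]), and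
the weights obey the same recursion ([dyson_weight_recursion]), except for
[T = S], where [g(0) = 0].

If [a_k = 0], then after clearing denominators the variable [x_k] occurs only in
[g] and in [prod_i (x_k - x_i)^(a_i)], and extracting the right coefficient in [x_k]
([slice]) leaves an instance of the claim for [S - k].  The two sides then
differ by an alternating sum over [T] of [g_q(1_T') ((-1)^r 'C(M, r) - 1)/(M + 1)],
where [T'] is the complement of [T] in [S - k], [M] is the sum of [a] over [T'],
[r = q - 1], and [g_q] is the coefficient of [x_k^q] in [g].  As
[(-1)^r 'C(M, r)] is a polynomial in [M] with value 1 at [M = -1], the summand is
a polynomial in the coordinates of [1_T'] of degree less than [#|S| - 1]
([signed_binomial_poly]), and such alternating sums vanish
([alt_sum_subsets_eq0]).

For the theorem, [S] is the full index set and [g] is the numerator times the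
variables outside [I0], so that [g(1_(~ T))] is 1 when [T] lies in [I0] and 0
otherwise.  Since [(1 + A) / (1 + A - sigma T) = 1 + sigma T / (1 + A - sigma T)]
and the sum of [(-1)^|T|] over the subsets of [I0] is zero, the formula takes the
announced shape. *)

(** * Alternating sums over subsets and Lagrange interpolation *)

Lemma sum_subsets_setD1 (V : nmodType) (I : finType) (S : {set I}) (k : I)
    (f : {set I} -> V) : k \in S ->
  \sum_(T : {set I} | T \subset S) f T =
  \sum_(T : {set I} | T \subset S :\ k) (f T + f (k |: T)).
Proof.
move=> kS; rewrite big_split /= (bigID (fun T : {set I} => k \notin T)) /=.
congr (_ + _); first by apply: eq_bigl => T; rewrite subsetD1.
rewrite (reindex_onto (fun T : {set I} => k |: T) (fun T => T :\ k)) /=.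
  apply: eq_bigl => T; rewrite negbK setU11 subUset sub1set kS andbT /= subsetD1.
  case: (boolP (T \subset S)) => //= _.
  apply/eqP/idP => [<- | kT]; last by rewrite setU1K.
  by rewrite setD11.
by move=> T /andP[_]; rewrite negbK => kT; rewrite setD1K.
Qed.

Definition indic (R : pzSemiRingType) (n : nat) (U : {set 'I_n}) (i : 'I_n) : R :=
  (i \in U)%:R.

(** A monomial of degree less than [#|S|] misses some variable [i] of [S], so its
value does not change when [i] is moved in or out of [T], while the sign does. *)
Lemma alt_sum_subsets_eq0 (R : comNzRingType) (n : nat) (S : {set 'I_n})
    (P : {mpoly R[n]}) : (msize P <= #|S|)%N ->
  \sum_(T : {set 'I_n} | T \subset S)
    (-1) ^+ #|T| * P.@[indic R (S :\: T)] = 0.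
Proof.
move=> Psize.
under eq_bigr do rewrite mevalE big_distrr /=.
rewrite exchange_big /= big_seq big1 // => m mP.
have /exists_inP[i iS /eqP mi0] : [exists i in S, m i == 0%N].
  move: Psize; rewrite leqNgt; apply: contraNT.
  rewrite negb_exists_in => /forall_inP mS.
  apply: leq_trans (msize_mdeg_lt mP); rewrite ltnS mdegE -sum1_card.
  rewrite [leqRHS](bigID (mem S)) /= -[leqLHS]addn0 leq_add // leq_sum // => j /mS.
  by rewrite lt0n.
rewrite (sum_subsets_setD1 _ iS) big1 // => T; rewrite subsetD1 => /andP[_ iT].
rewrite cardsU1 iT exprS mulN1r mulNr.
apply/eqP; rewrite subr_eq0; apply/eqP; congr (_ * (_ * _)).
apply: eq_bigr => j _; have [-> | ji] := eqVneq j i; first by rewrite mi0 !expr0.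
by rewrite /indic !inE (negbTE ji).
Qed.

(** The interpolation polynomial of the constant 1 at the points [x k], evaluated
at 0. *)
Lemma lagrange_at0 (F : fieldType) (I : finType) (S : {set I}) (x : I -> F) :
  {in S &, injective x} -> S != set0 ->
  \sum_(k in S) \prod_(l in S :\ k) (x l / (x l - x k)) = 1.
Proof.
move=> x_inj S0.
pose p := \sum_(k in S) \prod_(l in S :\ k) ((x l - x k)^-1 *: ((x l)%:P - 'X)) - 1.
suff p0 : p = 0.
  have := congr1 (horner^~ 0) p0.
  rewrite /p hornerD hornerN hornerC horner0 horner_sum => /eqP.
  rewrite subr_eq0 => /eqP p1; apply: etrans p1; apply: eq_bigr => k _; rewrite horner_prod.
  apply: eq_bigr => l _.
  by rewrite hornerZ hornerD hornerN hornerC hornerX subr0 mulrC.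
have x_uniq : uniq [seq x k | k <- enum S].
  rewrite map_inj_in_uniq ?enum_uniq // => k l; rewrite !mem_enum; exact: x_inj.
apply: (roots_geq_poly_eq0 _ x_uniq); last first.
  rewrite size_map -cardE.
  have Spos : (0 < #|S|)%N by rewrite card_gt0.
  rewrite /p (leq_trans (size_polyD _ _)) // geq_max size_polyN size_poly1 Spos andbT.
  apply: (leq_trans (size_sum _ _ _)); apply/bigmax_leqP => k kS.
  apply: (leq_trans (size_poly_prod_leq _ _)).
  rewrite leq_subLR (cardsD1 k S) kS add1n.
  rewrite addnS ltnS.
  apply: leq_trans (_ : (\sum_(l in S :\ k) 2 <= _)%N).
    apply: leq_sum => l _; apply: leq_trans (size_scale_leq _ _) _.
    by rewrite -opprB size_polyN size_XsubC.
  by rewrite sum_nat_const muln2 -addnn.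
apply/allP => y /mapP[k]; rewrite mem_enum => kS ->{y}.
rewrite rootE /p hornerD hornerN hornerC horner_sum (bigD1 k) //=.
rewrite [X in _ + X - _]big1 => [|j /andP[jS jk]]; last first.
  rewrite horner_prod (bigD1 k) /=; last by rewrite !inE eq_sym jk.
  by rewrite !hornerE subrr mulr0 mul0r.
rewrite addr0 horner_prod big1 ?subrr // => l; rewrite !inE => /andP[lk lS].
rewrite !hornerE mulVf // subr_eq0; apply: contraNneq lk => /x_inj -> //.
Qed.

(** * The Dyson product and its recursion *)

(** The Dyson product over [S] with its denominators cleared. *)
Definition dyson (n : nat) (S : {set 'I_n}) (a : 'I_n -> nat) : {mpoly rat[n]} :=
  \prod_(k in S) \prod_(l in S :\ k) ('X_l - 'X_k) ^+ a k.

(** The exponent of [prod_i x_i^(1 + A - a_i)], with [A] the sum of [a] over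
[S]: the cleared denominators of the Dyson product times one more copy of each
variable.  The sum over [S :\ i] avoids a truncated subtraction. *)
Definition dyson_target (n : nat) (S : {set 'I_n}) (a : 'I_n -> nat) : 'X_{1..n} :=
  [multinom (if i \in S then (\sum_(l in S :\ i) a l).+1 else 0)%N | i < n].

Definition dyson_weight (n : nat) (S : {set 'I_n}) (a : 'I_n -> nat)
    (T : {set 'I_n}) : rat :=
  ((\sum_(k in S) a k).+1`!)%N%:R / (\prod_(k in S) (a k)`!)%N%:R
    / (\sum_(k in S :\: T) a k).+1%N%:R.

Definition decr (n : nat) (a : 'I_n -> nat) (k i : 'I_n) : nat := (a i - (i == k))%N.

Lemma sum_decr (n : nat) (a : 'I_n -> nat) (k : 'I_n) (U : {set 'I_n}) :
  (0 < a k)%N ->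
  (\sum_(i in U) a i = (k \in U) + \sum_(i in U) decr a k i)%N.
Proof.
move=> ak; have same V : k \notin V -> (\sum_(i in V) decr a k i = \sum_(i in V) a i)%N.
  move=> kV; apply: eq_bigr => i iV; rewrite /decr.
  by rewrite (_ : (i == k) = false) ?subn0 //; apply: contraNF kV => /eqP <-.
have [kU|kU] := boolP (k \in U); last by rewrite same.
rewrite !(big_setD1 k kU) /= same ?setD11 // /decr eqxx addnA.
by rewrite subnKC.
Qed.

Lemma dyson_target_decr (n : nat) (S : {set 'I_n}) (a : 'I_n -> nat) (k : 'I_n) :
  (0 < a k)%N -> k \in S ->
  dyson_target S a = (\sum_(l in S :\ k) U_(l) + dyson_target S (decr a k))%MM.
Proof.
move=> ak kS; apply/mnmP => i; rewrite mnmDE mnm_sumE !mnmE.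
have -> : (\sum_(l in S :\ k) U_(l)%MM i = (i \in S :\ k))%N.
  under eq_bigr do rewrite mnm1E.
  have [iSk|iSk] := boolP (i \in S :\ k).
    rewrite (big_setD1 i iSk) /= eqxx big1 ?addn0 // => l.
    by rewrite !inE => /andP[/negbTE ->].
  by rewrite big1 // => l lSk; case: eqP => // li; rewrite -li lSk in iSk.
case: ifP => iS; last by rewrite !inE iS andbF.
rewrite (sum_decr _ ak) !inE iS kS /= !andbT addnS.
by rewrite eq_sym.
Qed.

Lemma dyson_decr (n : nat) (S : {set 'I_n}) (a : 'I_n -> nat) (k : 'I_n) :
  (0 < a k)%N -> k \in S ->
  dyson S a = (\prod_(l in S :\ k) ('X_l - 'X_k)) * dyson S (decr a k).
Proof.
move=> ak kS; rewrite /dyson !(big_setD1 k kS) /= [in RHS]mulrA -[in RHS]big_split /=.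
congr (_ * _).
  by apply: eq_bigr => l _; rewrite /decr eqxx -exprS subn1 prednK.
apply: eq_bigr => i; rewrite !inE => /andP[ik _].
by rewrite /decr (negbTE ik) subn0.
Qed.

(** Multiply [dyson S a] by the interpolation identity
[sum_k prod_l x_l / (x_l - x_k) = 1]; the [k]-th denominator is the quotient of
[dyson S a] by [dyson S (decr a k)]. *)
Lemma dyson_recursion (n : nat) (S : {set 'I_n}) (a : 'I_n -> nat) :
  S != set0 -> {in S, forall k, 0 < a k}%N ->
  dyson S a = \sum_(k in S) (\prod_(l in S :\ k) 'X_l) * dyson S (decr a k).
Proof.
move=> S0 apos; pose x (k : 'I_n) : ratfun n := tofrac 'X_k.
have X_inj : injective (fun k : 'I_n => 'X_k : {mpoly rat[n]}).
  move=> k l /(congr1 (mcoeff U_(k))); rewrite !mcoeffXU eqxx.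
  by case: eqP => // _ /eqP; rewrite oner_eq0.
have x_inj : injective x.
  by move=> k l /eqP; rewrite tofrac_eq => /eqP; exact: X_inj.
apply/eqP; rewrite -tofrac_eq; apply/eqP.
rewrite -[LHS]mulr1 -(@lagrange_at0 _ _ S x (in2W x_inj) S0) rmorph_sum mulr_sumr.
apply: eq_bigr => k kS; rewrite (dyson_decr (apos k kS) kS).
rewrite !rmorphM /= !rmorph_prod /= mulrAC; congr (_ * _).
rewrite -big_split; apply: eq_bigr => l; rewrite !inE => /andP[lk _] /=.
by rewrite rmorphB mulrCA divff ?mulr1 // subr_eq0 (inj_eq x_inj).
Qed.

(** Lowering [a k] lowers the denominator [1 + A - sigma T] exactly when [k] is
outside [T], so the sum is proportional to
[sigma T / (1 + A - sigma T) + (A - sigma T) / (A - sigma T)].  The second fraction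
is 1 only if [A - sigma T] is nonzero, hence the exclusion of [T = S]. *)
Lemma dyson_weight_recursion (n : nat) (S T : {set 'I_n}) (a : 'I_n -> nat) :
  T \subset S -> T != S -> {in S, forall k, 0 < a k}%N ->
  \sum_(k in S) dyson_weight S (decr a k) T = dyson_weight S a T.
Proof.
move=> TS TneS apos.
have {TneS} [k0 k0S k0T] : exists2 k, k \in S & k \notin T.
  by apply/subsetPn; apply: contra TneS => ST; rewrite eqEsubset TS.
set A := (\sum_(k in S) a k)%N; set N := (\sum_(k in S :\: T) a k)%N.
set f := (\prod_(k in S) (a k)`!)%N.
have N0 : N%:R != 0 :> rat.
  rewrite pnatr_eq0 -lt0n /N (big_setD1 k0) ?inE ?k0S ?k0T //=.
  by rewrite ltn_addr ?apos.
have f0 : f%:R != 0 :> rat.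
  by rewrite pnatr_eq0 -lt0n prodn_gt0 // => k; rewrite fact_gt0.
have step k : k \in S -> dyson_weight S (decr a k) T =
    A`!%:R / f%:R * ((a k)%:R / (N + (k \in T))%:R).
  move=> kS; have ak := apos k kS.
  rewrite /dyson_weight /A /N !(sum_decr _ ak) kS add1n inE kS andbT.
  have -> : f = (a k * \prod_(i in S) (decr a k i)`!)%N.
    rewrite /f !(big_setD1 k kS) /= mulnA; congr (_ * _)%N.
      by rewrite /decr eqxx subn1 -[in LHS](prednK ak) factS prednK.
    apply: eq_bigr => i; rewrite !inE => /andP[ik _].
    by rewrite /decr (negbTE ik) subn0.
  set g := (\prod_(i in S) (decr a k i)`!)%N.
  have -> : ((k \notin T) + \sum_(i in S :\: T) decr a k i + (k \in T) =
      (\sum_(i in S :\: T) decr a k i).+1)%N.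
    by case: (k \in T) => /=; rewrite ?addn0 ?addn1 ?add1n.
  have ak0 : (a k)%:R != 0 :> rat by rewrite pnatr_eq0 -lt0n.
  have g0 : g%:R != 0 :> rat.
    by rewrite pnatr_eq0 -lt0n prodn_gt0 // => i; rewrite fact_gt0.
  move: (\sum_(i in S :\: T) decr a k i).+1 (ltn0Sn (\sum_(i in S :\: T) decr a k i)).
  move=> D; rewrite lt0n -(pnatr_eq0 rat) => D0.
  by rewrite natrM; field; rewrite D0 g0 ak0.
rewrite (eq_bigr _ step) -mulr_sumr (big_setID T) /= (setIidPr TS).
have -> : \sum_(i in T) (a i)%:R / (N + (i \in T))%:R =
    (\sum_(i in T) a i)%N%:R / N.+1%:R :> rat.
  by rewrite natr_sum mulr_suml; apply: eq_bigr => i iT; rewrite iT addn1.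
have -> : \sum_(i in S :\: T) (a i)%:R / (N + (i \in T))%:R = 1 :> rat.
  rewrite (eq_bigr (fun i => (a i)%:R / N%:R)) => [|i].
    by rewrite -mulr_suml -natr_sum divff.
  by rewrite inE => /andP[/negbTE -> _]; rewrite addn0.
have AE : A = (\sum_(i in T) a i + N)%N.
  by rewrite /A (big_setID T) /= (setIidPr TS).
rewrite /dyson_weight -/A -/N -/f. rewrite factS natrM.
have N1 : N.+1%:R != 0 :> rat by rewrite pnatr_eq0.
have -> : A.+1%:R = (\sum_(i in T) a i)%N%:R + N.+1%:R :> rat.
  by rewrite AE -addnS natrD.
by move: (N.+1%:R) N1 => z z0; field; rewrite z0 f0.
Qed.

(** * Coefficients in a single variable *)

Definition free_of (n : nat) (k : 'I_n) (p : {mpoly rat[n]}) : Prop :=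
  {in msupp p, forall m : 'X_{1..n}, m k = 0%N}.

Lemma free_of1 (n : nat) (k : 'I_n) : free_of k 1.
Proof. by move=> m; rewrite msupp1 inE => /eqP ->; rewrite mnm0E. Qed.

Lemma free_ofX (n : nat) (k l : 'I_n) : l != k -> free_of k 'X_l.
Proof.
by move=> lk m; rewrite msuppX inE => /eqP ->; rewrite mnm1E (negbTE lk).
Qed.

Lemma free_ofB (n : nat) (k : 'I_n) (p q : {mpoly rat[n]}) :
  free_of k p -> free_of k q -> free_of k (p - q).
Proof.
move=> kp kq m /msuppB_le; rewrite mem_cat => /orP[]; [exact: kp | exact: kq].
Qed.

Lemma free_ofM (n : nat) (k : 'I_n) (p q : {mpoly rat[n]}) :
  free_of k p -> free_of k q -> free_of k (p * q).
Proof.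
move=> kp kq m /msuppM_le/allpairsP[[m1 m2] /= [/kp k1 /kq k2 ->]].
by rewrite mnmDE k1 k2.
Qed.

Lemma free_of_exp (n : nat) (k : 'I_n) (p : {mpoly rat[n]}) (e : nat) :
  free_of k p -> free_of k (p ^+ e).
Proof.
move=> kp; elim: e => [|e IHe]; first exact: free_of1.
by rewrite exprS; exact: free_ofM.
Qed.

Lemma free_of_dyson (n : nat) (k : 'I_n) (S : {set 'I_n}) (a : 'I_n -> nat) :
  k \notin S -> free_of k (dyson S a).
Proof.
move=> kS.
have Sk i : i \in S -> i != k by move=> iS; apply: contraNneq kS => <-.
apply: (big_ind (free_of k)); [exact: free_of1 | exact: free_ofM |].
move=> i /Sk ik; apply: (big_ind (free_of k)); [exact: free_of1 | exact: free_ofM |].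
move=> l; rewrite inE => /andP[_ /Sk lk].
by apply/free_of_exp/free_ofB; exact: free_ofX.
Qed.

(** The coefficient of [x_k^q] in [g], kept as a polynomial in the same ring. *)
Definition slice (n : nat) (k : 'I_n) (q : nat) (g : {mpoly rat[n]}) : {mpoly rat[n]} :=
  \sum_(m <- msupp g | m k == q) g@_m *: 'X_[m - U_(k) *+ q].

Lemma subm_mulU (n : nat) (k : 'I_n) (m : 'X_{1..n}) :
  m = (m - U_(k) *+ m k + U_(k) *+ m k)%MM.
Proof.
rewrite submK //; apply/mnm_lepP => i; rewrite mulmnE mnm1E.
by case: eqP => [->|_]; rewrite ?mul1n ?mul0n.
Qed.

Lemma sum_sliceE (n : nat) (k : 'I_n) (g : {mpoly rat[n]}) (Q : nat) :
  (msize g <= Q)%N -> g = \sum_(q < Q) slice k q g * 'X_k ^+ q.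
Proof.
move=> gQ; rewrite {1}[g]mpolyE.
have term (q : 'I_Q) : slice k q g * 'X_k ^+ q =
    \sum_(m <- msupp g | m k == q :> nat) g@_m *: 'X_[m].
  rewrite mulr_suml; apply: eq_bigr => m /eqP mq.
  by rewrite mpolyXn -scalerAl -mpolyXD -mq -subm_mulU.
rewrite (eq_bigr _ (fun q _ => term q)) (exchange_big_dep predT) //=.
rewrite big_seq [RHS]big_seq; apply: eq_bigr => m mg.
have mQ : (m k < Q)%N.
  apply: leq_trans gQ; apply: leq_ltn_trans (msize_mdeg_lt mg).
  by rewrite mdegE (bigD1 k) //= leq_addr.
by rewrite (big_pred1 (Ordinal mQ)) // => q; rewrite /= eq_sym.
Qed.

Lemma free_of_slice (n : nat) (k : 'I_n) (q : nat) (g : {mpoly rat[n]}) :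
  free_of k (slice k q g).
Proof.
move=> m /msupp_sum_le /flatten_mapP[m']; rewrite mem_filter => /andP[/eqP mq _].
move/msuppZ_le; rewrite msuppX inE => /eqP ->.
by rewrite mnmBE mulmnE mnm1E eqxx mul1n mq subnn.
Qed.

Lemma slice_homog (n : nat) (k : 'I_n) (q d : nat) (g : {mpoly rat[n]}) :
  g \is d.-homog -> slice k q g \is (d - q).-homog.
Proof.
move=> /dhomogP gd; rewrite /slice big_seq_cond;
apply: rpred_sum => m /andP[/gd mg /eqP mq].
have mE : mdeg m = (mdeg (m - U_(k) *+ q)%MM + q)%N.
  by rewrite {1}(subm_mulU k m) mdegD mdegMn mdeg1 mul1n mq.
by apply: rpredZ; rewrite dhomogX /= -mg /= mE addnK.
Qed.

(** When [P] does not involve [x_k], the exponent of [x_k] has to come from [g]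
alone. *)
Lemma mcoeff_slice (n : nat) (k : 'I_n) (g P : {mpoly rat[n]}) (t : 'X_{1..n}) :
  free_of k P ->
  (g * P)@_t = (slice k (t k) g * P)@_(t - U_(k) *+ t k).
Proof.
move=> kP; have [Q gQ tQ] : exists2 Q, (msize g <= Q)%N & (t k < Q)%N.
  by exists (msize g + (t k).+1)%N; rewrite ?leq_addr ?ltn_addl.
rewrite [in LHS](sum_sliceE k gQ) mulr_suml raddf_sum /=.
have tE := mcoeffMX (slice k (t k) g * P) (U_(k) *+ t k) (t - U_(k) *+ t k).
rewrite addmC -subm_mulU in tE.
rewrite (bigD1 (Ordinal tQ)) //= mulrAC mpolyXn tE big1 ?addr0 // => q qt.
rewrite mulrAC mpolyXn.
apply: memN_msupp_eq0; rewrite (perm_mem (msuppMX _ _)).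
apply: contra qt => /mapP[m mP tq]; apply/eqP/val_inj => /=.
rewrite tq mnmDE mulmnE mnm1E eqxx mul1n.
by rewrite (free_ofM (@free_of_slice n k q g) kP mP) addn0.
Qed.

(** Specializes every variable but [x_k]; a ring morphism whose coefficients are
the values of the slices ([coef_meval_except]), which turns questions about slices
of a product into univariate ones. *)
Definition meval_except (n : nat) (k : 'I_n) (v : 'I_n -> rat)
    (g : {mpoly rat[n]}) : {poly rat} :=
  mmap (@polyC rat) (fun i => if i == k then 'X else (v i)%:P) g.

Lemma meval_except_free (n : nat) (k : 'I_n) (v : 'I_n -> rat) (g : {mpoly rat[n]}) :
  free_of k g -> meval_except k v g = (g.@[v])%:P.
Proof.
move=> kg; rewrite /meval_except /meval /mmap rmorph_sum /= big_seq [RHS]big_seq.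
apply: eq_bigr => m /kg mk; rewrite polyCM; congr (_ * _).
rewrite /mmap1 rmorph_prod; apply: eq_bigr => i _ /=; rewrite polyC_exp.
by case: eqP => // ->; rewrite mk !expr0.
Qed.

Lemma meval_exceptE (n : nat) (k : 'I_n) (v : 'I_n -> rat) (g : {mpoly rat[n]}) (Q : nat) :
  (msize g <= Q)%N ->
  meval_except k v g = \sum_(q < Q) (slice k q g).@[v] *: 'X^q.
Proof.
move=> gQ; rewrite {1}(sum_sliceE k gQ) /meval_except rmorph_sum /=.
apply: eq_bigr => q _; rewrite rmorphM rmorphXn /= -/(meval_except _ _ _).
rewrite meval_except_free; last exact: free_of_slice.
by rewrite mmapX mmap1U eqxx mul_polyC.
Qed.

Lemma coef_meval_except (n : nat) (k : 'I_n) (v : 'I_n -> rat)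
    (g : {mpoly rat[n]}) (q : nat) :
  (meval_except k v g)`_q = (slice k q g).@[v].
Proof.
have Q0 : (q < msize g + q.+1)%N by rewrite ltn_addl.
rewrite (meval_exceptE _ _ (leq_addr q.+1 _)) coef_sum (bigD1 (Ordinal Q0)) //=.
rewrite coefZ coefXn eqxx mulr1 big1 ?addr0 // => j jq.
by rewrite coefZ coefXn (_ : (q == j) = false) ?mulr0 // eq_sym; apply/negbTE.
Qed.

Lemma horner_meval_except (n : nat) (k : 'I_n) (v : 'I_n -> rat)
    (g : {mpoly rat[n]}) (y : rat) :
  (meval_except k v g).[y] = g.@[fun i => if i == k then y else v i].
Proof.
rewrite /meval_except /meval /mmap horner_sum; apply: eq_bigr => m _.
rewrite hornerM hornerC; congr (_ * _); rewrite /mmap1 horner_prod.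
by apply: eq_bigr => i _; rewrite horner_exp; case: ifP; rewrite ?hornerX ?hornerC.
Qed.

(** * Binomial coefficients as polynomials of low degree *)

Lemma coef_exp_XsubC1 (M r : nat) :
  ('X^r * ('X - 1) ^+ M : {poly rat})`_M = (-1) ^+ r * 'C(M, r)%:R.
Proof.
rewrite coefXnM; case: ltnP => [Mr | rM]; first by rewrite bin_small ?mulr0.
have coef_term (i : nat) :
    ((-1) ^+ i * 'X^(M - i) * 1 ^+ i *+ 'C(M, i) : {poly rat})`_(M - r) =
    (-1) ^+ i * (M - r == M - i)%N%:R * 'C(M, i)%:R.
  have -> : (-1) ^+ i = ((-1) ^+ i)%:P :> {poly rat} by rewrite rmorphXn rmorphN1.
  rewrite expr1n mulr1 coefMn coefCM coefXn; exact/esym/mulr_natr.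
rewrite exprBn coef_sum (bigD1 (Ordinal (rM : (r < M.+1)%N))) //= coef_term eqxx mulr1.
rewrite big1 ?addr0 // => i ir; rewrite coef_term.
rewrite (_ : (M - r == M - i)%N = false) ?mulr0 ?mul0r //.
rewrite eqn_sub2lE //; last by rewrite -ltnS.
by apply: contraNF ir => /eqP ir; apply/eqP/val_inj.
Qed.

(** In terms of [N = M + 1] one has [(-1)^r 'C(M, r) = prod_(1 <= j <= r) (1 - N / j)],
a polynomial in [N] of degree [r] with constant term 1. *)
Lemma signed_binomial_poly (r : nat) :
  exists2 rho : {poly rat}, (size rho <= r)%N
    & forall M, (-1) ^+ r * 'C(M, r)%:R = 1 + M.+1%:R * rho.[M.+1%:R].
Proof.
elim: r => [|r [rho rho_size rhoE]].
  by exists 0 => [|M]; rewrite ?size_poly0 // bin0 horner0 mulr0 addr0 mulr1.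
have r1 : r.+1%:R != 0 :> rat by rewrite pnatr_eq0.
(* Solves 1 + N rho' = (1 + N rho) (1 - N / (r + 1)) for rho'. *)
exists (rho - r.+1%:R^-1 *: (1 + 'X * rho)).
  rewrite (leq_trans (size_polyD _ _)) // geq_max (leq_trans rho_size) //=.
  rewrite size_polyN (leq_trans (size_scale_leq _ _)) //.
  rewrite (leq_trans (size_polyD _ _)) // geq_max size_poly1 /=.
  have [-> | rho0] := eqVneq rho 0; first by rewrite mulr0 size_poly0.
  by rewrite mulrC size_mulX.
move=> M; rewrite !hornerE.
have step : r.+1%:R * 'C(M, r.+1)%:R = (M%:R - r%:R) * 'C(M, r)%:R :> rat.
  have [rM | Mr] := leqP r M; last by rewrite !bin_small ?mulr0 // ltnW.
  by rewrite -natrM mul_bin_left natrM natrB.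
have -> : 'C(M, r.+1)%:R = (M%:R - r%:R) * 'C(M, r)%:R / r.+1%:R :> rat.
  by rewrite -step mulrC mulKf.
rewrite exprS -mulrA [X in -1 * X]mulrA [X in -1 * (X / _)]mulrCA rhoE.
move: rho.[_] => y; move: r1; rewrite -[M.+1]addn1 -[r.+1]addn1 !natrD => r1.
by field.
Qed.

(** * Removing an index with zero exponent *)

Lemma dyson_setD1 (n : nat) (S : {set 'I_n}) (a : 'I_n -> nat) (k : 'I_n) :
  k \in S -> a k = 0%N ->
  dyson S a = \prod_(i in S :\ k) ('X_k - 'X_i) ^+ a i * dyson (S :\ k) a.
Proof.
move=> kS ak; rewrite /dyson (big_setD1 k kS) /= big1 ?mul1r => [|l _]; last first.
  by rewrite ak expr0.
rewrite -big_split; apply: eq_bigr => i; rewrite !inE => /andP[ik iS] /=.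
rewrite (big_setD1 k) /=; last by rewrite !inE eq_sym ik.
by congr (_ * _); apply: eq_bigl => l; rewrite !inE andbCA.
Qed.

Lemma dyson_target_setD1 (n : nat) (S : {set 'I_n}) (a : 'I_n -> nat) (k : 'I_n) :
  k \in S -> a k = 0%N ->
  (dyson_target S a - U_(k) *+ dyson_target S a k)%MM = dyson_target (S :\ k) a.
Proof.
move=> kS ak; apply/mnmP => i; rewrite mnmBE mulmnE mnm1E.
have [<- | ik] := eqVneq k i; first by rewrite mul1n subnn mnmE setD11.
rewrite mul0n subn0 !mnmE !inE eq_sym ik /=; case: ifP => // iS.
rewrite (big_setD1 k) /=; last by rewrite !inE ik.
by rewrite ak add0n; congr (_.+1); apply: eq_bigl => l; rewrite !inE andbCA.
Qed.

Lemma dyson_weight_setD1 (n : nat) (S T : {set 'I_n}) (a : 'I_n -> nat) (k : 'I_n) :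
  k \in S -> a k = 0%N ->
  dyson_weight S a T = dyson_weight (S :\ k) a (T :\ k).
Proof.
move=> kS ak; rewrite /dyson_weight !(big_setD1 k kS) /= ak fact0 mul1n add0n.
congr (_ / _.+1%:R).
rewrite [LHS](bigID (pred1 k)) /= big1 => [|i /andP[_ /eqP ->//]].
rewrite add0n; apply: eq_bigl => i; rewrite !inE.
by case: eqP; rewrite /= ?andbT ?andbF.
Qed.

Lemma dhomog_prod_exp (n : nat) (k : 'I_n) (U : {set 'I_n}) (a : 'I_n -> nat) :
  (\prod_(i in U) ('X_k - 'X_i) ^+ a i : {mpoly rat[n]})
    \is (\sum_(i in U) a i).-homog.
Proof.
apply: (big_ind2 (fun (p : {mpoly rat[n]}) d => p \is d.-homog)).
- exact: dhomog1.
- by move=> p d q e; exact: dhomogM.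
move=> i _; rewrite -{2}[a i]mul1n; apply: dhomogMn.
by apply: rpredB; rewrite dhomogX /= mdeg1.
Qed.

(** At the point [indic rat (S :\: T)] the factors with index in [T] become powers
of ['X], the others powers of ['X - 1]. *)
Lemma meval_except_prod (n : nat) (k : 'I_n) (S T : {set 'I_n}) (a : 'I_n -> nat) :
  k \notin S -> T \subset S ->
  meval_except k (indic rat (S :\: T)) (\prod_(i in S) ('X_k - 'X_i) ^+ a i) =
  'X^(\sum_(i in T) a i) * ('X - 1) ^+ (\sum_(i in S :\: T) a i).
Proof.
move=> kS TS.
rewrite /meval_except rmorph_prod /= (big_setID T) /= (setIidPr TS).
have factor i : i \in S -> mmap (@polyC rat)
    (fun j => if j == k then 'X else (indic rat (S :\: T) j)%:P)
    (('X_k - 'X_i) ^+ a i) = ('X - (i \notin T)%:R) ^+ a i.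
  move=> iS; rewrite rmorphXn rmorphB /= !mmapX !mmap1U eqxx.
  rewrite ifN; last by apply: contraNneq kS => <-.
  by rewrite /indic inE iS andbT polyC_natr.
rewrite !expr_sum; congr (_ * _).
  apply: eq_bigr => i iT; rewrite factor ?(subsetP TS) //.
  by rewrite iT subr0.
by apply: eq_bigr => i; rewrite inE => /andP[iT iS]; rewrite factor // iT.
Qed.

Lemma msize_mul_le (n d e : nat) (p q : {mpoly rat[n]}) :
  (msize p <= d.+1)%N -> (msize q <= e.+1)%N -> (msize (p * q) <= (d + e).+1)%N.
Proof.
move=> pd qe; have [-> | p0] := eqVneq p 0; first by rewrite mul0r msize0.
have [-> | q0] := eqVneq q 0; first by rewrite mulr0 msize0.
rewrite msizeM //; apply: leq_trans (_ : (d.+1 + e.+1).-1 <= _)%N.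
  by rewrite -!subn1 leq_sub2r // leq_add.
by rewrite addnS.
Qed.

Lemma msize_exp_le (n s : nat) (L : {mpoly rat[n]}) :
  (msize L <= 2)%N -> (msize (L ^+ s) <= s.+1)%N.
Proof.
move=> L2; elim: s => [|s IHs]; first by rewrite msize1.
by rewrite exprS; exact: (@msize_mul_le _ 1 s).
Qed.

Lemma msize_homog_le (n d : nat) (p : {mpoly rat[n]}) :
  p \is d.-homog -> (msize p <= d.+1)%N.
Proof.
move=> /dhomogP pd; rewrite msizeE; apply/bigmax_leqP_seq => m mp _.
by rewrite -(pd m mp).
Qed.

(** The number [M + 1], with [M] the sum of [a] over [U :\: T], is the value at
[indic rat (U :\: T)] of an affine form, and the fraction is a polynomial in it of
degree less than [r]; together with [p] the total degree stays below [#|U|]. *)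
Lemma alt_sum_binomial_eq0 (n : nat) (U : {set 'I_n}) (a : 'I_n -> nat)
    (p : {mpoly rat[n]}) (d r : nat) :
  p \is d.-homog -> (d + r <= #|U|)%N ->
  \sum_(T : {set 'I_n} | T \subset U)
    (-1) ^+ #|T| * (p.@[indic rat (U :\: T)] *
      (((-1) ^+ r * 'C(\sum_(i in U :\: T) a i, r)%:R - 1)
         / (\sum_(i in U :\: T) a i).+1%N%:R)) = 0.
Proof.
move=> pd dr; have [rho rho_size rhoE] := signed_binomial_poly r.
pose L : {mpoly rat[n]} := 1 + \sum_(i in U) (a i)%:R *: 'X_i.
have L_size : (msize L <= 2)%N.
  apply: leq_trans (msizeD_le _ _) _; rewrite geq_max msize1 /=.
  apply: (leq_trans (msize_sum _ _ _)); apply/bigmax_leqP => i _.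
  by apply: leq_trans (msizeZ_le _ _) _; rewrite msizeX mdeg1.
have L_eval (T : {set 'I_n}) : T \subset U ->
    L.@[indic rat (U :\: T)] = (\sum_(i in U :\: T) a i).+1%N%:R.
  move=> TU; rewrite /L mevalD meval1 raddf_sum /= -natr1 addrC; congr (_ + 1).
  rewrite (big_setID T) /= (setIidPr TU) big1 ?add0r => [|i iT].
    rewrite natr_sum; apply: eq_bigr => i iUT.
    by rewrite mevalZ mevalXU /indic iUT mulr1.
  by rewrite mevalZ mevalXU /indic inE iT mulr0.
transitivity (\sum_(T : {set 'I_n} | T \subset U) \sum_(s < size rho)
    rho`_s * ((-1) ^+ #|T| * (p * L ^+ s).@[indic rat (U :\: T)])).
  apply: eq_bigr => T TU; rewrite rhoE addrAC subrr add0r mulrAC.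
  rewrite mulfV ?mul1r ?pnatr_eq0 // horner_coef !mulr_sumr.
  apply: eq_bigr => s _; rewrite mevalM rmorphXn /= L_eval //.
  by rewrite [RHS]mulrCA; congr (_ * _); rewrite mulrCA.
rewrite exchange_big big1 // => s _; rewrite -mulr_sumr alt_sum_subsets_eq0 ?mulr0 //.
apply: leq_trans dr; apply: leq_trans (_ : (d + s).+1 <= _)%N.
  by apply: msize_mul_le; [exact: msize_homog_le | exact: msize_exp_le].
by rewrite -addnS leq_add2l (leq_trans (ltn_ord s)).
Qed.

(** Writing [sigma] and [M] for the sums of [a] over [T] and [S :\: T], this is the
coefficient of ['X^(sigma + M + 1)] in [g(X) * 'X^sigma * ('X - 1)^M], where [g(X)]
is [g] with every variable but [x_k] specialized.  The constant term of [g(X)] cannot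
contribute, because ['X^sigma * ('X - 1)^M] has degree [sigma + M]. *)
Lemma eval_slice_prod (n : nat) (S T : {set 'I_n}) (a : 'I_n -> nat)
    (k : 'I_n) (g : {mpoly rat[n]}) (d : nat) :
  k \notin S -> T \subset S -> g \is d.-homog ->
  (slice k (\sum_(i in S) a i).+1
     (g * \prod_(i in S) ('X_k - 'X_i) ^+ a i)).@[indic rat (S :\: T)] =
  \sum_(r < d) (slice k r.+1 g).@[indic rat (S :\: T)]
     * ((-1) ^+ r * 'C(\sum_(i in S :\: T) a i, r)%:R).
Proof.
move=> kS TS gd; set v := indic rat (S :\: T).
rewrite -coef_meval_except.
have -> : meval_except k v (g * \prod_(i in S) ('X_k - 'X_i) ^+ a i) =
    meval_except k v g * meval_except k v (\prod_(i in S) ('X_k - 'X_i) ^+ a i).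
  exact: rmorphM.
rewrite meval_except_prod // (meval_exceptE _ _ (msize_homog_le gd)).
have -> : (\sum_(i in S) a i = \sum_(i in T) a i + \sum_(i in S :\: T) a i)%N.
  by rewrite (big_setID T) /= (setIidPr TS).
set sigma := (\sum_(i in T) a i)%N; set M := (\sum_(i in S :\: T) a i)%N.
have coef_term (c : rat) (q : nat) :
    (c *: 'X^q * ('X^sigma * ('X - 1) ^+ M))`_(sigma + M).+1 =
    c * ('X^q * ('X - 1) ^+ M)`_M.+1.
  rewrite -scalerAl coefZ mulrCA [in LHS]coefXnM -addnS.
  have -> := leq_gtF (leq_addr M.+1 sigma).
  by rewrite addKn.
rewrite mulr_suml coef_sum big_ord_recl coef_term expr0 mul1r.
rewrite nth_default ?mulr0 ?add0r; last by rewrite size_exp_XsubC.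
apply: eq_bigr => r _; rewrite coef_term lift0 exprS -mulrA coefXM /=.
by rewrite coef_exp_XsubC1.
Qed.

(** Both points agree with [indic rat (S :\ k :\: T)] except for [x_k], which is 1
in the first and 0 in the second, so the difference collects the positive powers
of [x_k]. *)
Lemma eval_setD1_split (n : nat) (S T : {set 'I_n}) (k : 'I_n)
    (g : {mpoly rat[n]}) (d : nat) :
  k \in S -> T \subset S :\ k -> g \is d.-homog ->
  g.@[indic rat (S :\: T)] - g.@[indic rat (S :\: (k |: T))] =
  \sum_(r < d) (slice k r.+1 g).@[indic rat ((S :\ k) :\: T)].
Proof.
move=> kS; rewrite subsetD1 => /andP[TS kT] gd; set v := indic rat (S :\ k :\: T).
have -> : g.@[indic rat (S :\: T)] = (meval_except k v g).[1].
  rewrite horner_meval_except; apply: meval_eq => i; rewrite /v /indic !inE.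
  by have [-> | ik] := eqVneq i k; rewrite ?kT ?kS.
have -> : g.@[indic rat (S :\: (k |: T))] = (meval_except k v g).[0].
  rewrite horner_meval_except; apply: meval_eq => i; rewrite /v /indic !inE.
  by have [-> | ik] := eqVneq i k.
rewrite (meval_exceptE _ _ (msize_homog_le gd)) !horner_sum -sumrB big_ord_recl.
rewrite !hornerZ !hornerXn !expr0 subrr add0r; apply: eq_bigr => r _.
by rewrite !hornerZ !hornerXn lift0 /= expr1n exprS mul0r mulr0 subr0 mulr1.
Qed.

(** The right-hand side for [S] reduces to the one for [S :\ k]: pairing [T] with
[k |: T] leaves for each [T] the sum of all [g_q] with [q > 0], and replacing each
[g_q] by [g_q] times a signed binomial coefficient costs only an alternating sum of
low degree. *)
Lemma alt_sum_slice (n : nat) (S : {set 'I_n}) (a : 'I_n -> nat) (k : 'I_n)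
    (g : {mpoly rat[n]}) :
  k \in S -> a k = 0%N -> g \is #|S|.-homog ->
  \sum_(T : {set 'I_n} | T \subset S :\ k)
    (-1) ^+ #|T| * dyson_weight (S :\ k) a T *
    (slice k (\sum_(i in S :\ k) a i).+1
      (g * \prod_(i in S :\ k) ('X_k - 'X_i) ^+ a i)).@[indic rat ((S :\ k) :\: T)] =
  \sum_(T : {set 'I_n} | T \subset S)
    (-1) ^+ #|T| * dyson_weight S a T * g.@[indic rat (S :\: T)].
Proof.
move=> kS ak gS; set U := S :\ k.
have kU : k \notin U by rewrite setD11.
have cardS : #|S| = #|U|.+1 by rewrite (cardsD1 k S) kS.
rewrite [RHS](sum_subsets_setD1 _ kS) -/U.
apply/eqP; rewrite -subr_eq0 -sumrB; apply/eqP.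
set C : rat := (((\sum_(i in U) a i).+1)`!)%N%:R / (\prod_(i in U) (a i)`!)%N%:R.
rewrite (eq_bigr (fun T : {set 'I_n} => \sum_(r < #|S|) C *
   ((-1) ^+ #|T| * ((slice k r.+1 g).@[indic rat (U :\: T)] *
      (((-1) ^+ r * 'C(\sum_(i in U :\: T) a i, r)%:R - 1)
         / (\sum_(i in U :\: T) a i).+1%N%:R))))).
  rewrite exchange_big big1 // => r _; rewrite -mulr_sumr.
  rewrite (alt_sum_binomial_eq0 _ (slice_homog k r.+1 gS)) ?mulr0 //.
  by rewrite -ltnS -cardS -addnS subnK.
move=> T TU; have /andP[TS kT] : (T \subset S) && (k \notin T) by rewrite -subsetD1.
rewrite (eval_slice_prod _ kU TU gS).
have wT : dyson_weight S a T = dyson_weight U a T.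
  rewrite (dyson_weight_setD1 _ kS ak); congr dyson_weight; apply/setP => i.
  by rewrite !inE; case: eqP => // ->; rewrite (negbTE kT).
have wkT : dyson_weight S a (k |: T) = dyson_weight U a T.
  by rewrite (dyson_weight_setD1 _ kS ak) setU1K.
rewrite wT wkT cardsU1 kT exprS mulN1r !mulNr -mulrBr.
rewrite (eval_setD1_split kS TU gS) -/U -mulrBr -sumrB mulr_sumr.
apply: eq_bigr => r _; rewrite /dyson_weight -/C; ring.
Qed.

Lemma dyson_target_at (n : nat) (S : {set 'I_n}) (a : 'I_n -> nat) (k : 'I_n) :
  k \in S -> dyson_target S a k = (\sum_(l in S :\ k) a l).+1.
Proof. by move=> kS; rewrite mnmE kS. Qed.

(** * The constant term of a homogeneous numerator *)

(** Induction on [#|S|] plus the sum of [a] over [S]: a vanishing exponent removes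
its index, and if all are positive the Lagrange recursion lowers one of them. *)
Theorem mcoeff_dyson (n : nat) (S : {set 'I_n}) (a : 'I_n -> nat) (g : {mpoly rat[n]}) :
  g \is #|S|.-homog ->
  (g * dyson S a)@_(dyson_target S a) =
  \sum_(T : {set 'I_n} | T \subset S)
    (-1) ^+ #|T| * dyson_weight S a T * g.@[indic rat (S :\: T)].
Proof.
have [N] := ubnP (#|S| + \sum_(i in S) a i)%N.
elim: N S a g => // N IHN S a g; rewrite ltnS => SaN gS.
have [S0 | Sn0] := eqVneq S set0.
  rewrite {}S0 in gS SaN *.
  have gC : g = (g@_0%MM)%:MP.
    by apply: msize1_polyC; rewrite cards0 in gS; exact: msize_homog_le gS.
  rewrite (big_pred1 set0) => [|T]; last by rewrite /= subset0.
  rewrite /dyson big_set0 mulr1 cards0 expr0 mul1r.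
  rewrite /dyson_weight setD0 !big_set0 !divr1 mul1r.
  have -> : dyson_target set0 a = 0%MM by apply/mnmP => i; rewrite !mnmE inE.
  by rewrite [in RHS]gC mevalC.
have [/existsP[k /andP[kS /eqP ak]] | apos] := boolP [exists k, (k \in S) && (a k == 0%N)].
  rewrite -(alt_sum_slice kS ak gS) (dyson_setD1 kS ak) mulrA.
  rewrite (@mcoeff_slice _ k); last by apply: free_of_dyson; rewrite setD11.
  rewrite (dyson_target_setD1 kS ak) (dyson_target_at a kS).
  have cardS : #|S| = #|S :\ k|.+1 by rewrite (cardsD1 k S) kS.
  apply: IHN.
    apply: leq_trans SaN; rewrite cardS (big_setD1 k kS) /= ak add0n addSn.
    by rewrite ltnS.
  have := slice_homog k (\sum_(i in S :\ k) a i).+1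
    (dhomogM gS (dhomog_prod_exp k (S :\ k) a)).
  by rewrite cardS addSn subSS addnK.
have {}apos : {in S, forall k, 0 < a k}%N.
  by move=> k kS; move: apos; rewrite negb_exists lt0n => /forallP/(_ k); rewrite kS.
rewrite (dyson_recursion Sn0 apos) mulr_sumr raddf_sum /=.
have step k : k \in S ->
    (g * (\prod_(l in S :\ k) 'X_l * dyson S (decr a k)))@_(dyson_target S a) =
    \sum_(T : {set 'I_n} | T \subset S)
      (-1) ^+ #|T| * dyson_weight S (decr a k) T * g.@[indic rat (S :\: T)].
  move=> kS; rewrite mulrCA mulrC mprodXE (dyson_target_decr (apos k kS) kS) mcoeffMX.
  apply: IHN => //; apply: leq_trans SaN; rewrite (sum_decr _ (apos k kS)) kS.
  by rewrite addnCA.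
rewrite (eq_bigr _ step) exchange_big /=; apply: eq_bigr => T TS.
rewrite -mulr_suml -mulr_sumr.
(* The weight of T = S does not satisfy the recursion, but g has positive degree
   and vanishes at the origin. *)
have [-> | TneS] := eqVneq T S; last by rewrite dyson_weight_recursion.
suff -> : g.@[indic rat (S :\: S)] = 0 by rewrite !mulr0.
rewrite setDv mevalE big_seq big1 // => m mg.
have mS := dhomog_mf gS mg.
have /existsP[i mi] : [exists i, m i != 0%N].
  rewrite -negb_forall; apply: contraNN Sn0 => /forallP m0.
  rewrite -cards_eq0 -mS /= mdegE big1 // => i _; exact/eqP/m0.
by rewrite (bigD1 i) //= /indic inE expr0n (negbTE mi) mul0r mulr0.
Qed.

(** * Laurent form of the identity *)

Lemma tofrac_dyson (n : nat) (a : 'I_n -> nat) :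
  tofrac (dyson setT a) =
  \prod_(kl : 'I_n * 'I_n | kl.1 != kl.2) (1 - xvar kl.1 / xvar kl.2) ^+ a kl.1
    * \prod_(kl : 'I_n * 'I_n | kl.1 != kl.2) xvar kl.2 ^+ a kl.1.
Proof.
rewrite /dyson rmorph_prod /= -big_split /=.
rewrite -(pair_big_dep predT (fun k l => k != l) (fun k l =>
  (1 - xvar k / xvar l) ^+ a k * xvar l ^+ a k)) /=.
apply: eq_big => [k | k _]; first by rewrite inE.
rewrite rmorph_prod /=; apply: eq_big => [l | l _]; first by rewrite !inE andbT eq_sym.
rewrite rmorphXn rmorphB /= -exprMn mulrBl mul1r mulfVK //.
rewrite /xvar tofrac_eq0; apply/eqP => /(congr1 (mcoeff U_(l))).
by rewrite mcoeffXU eqxx mcoeff0 => /eqP; rewrite oner_eq0.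
Qed.

Lemma tofrac_dyson_target (n : nat) (a : 'I_n -> nat) :
  tofrac ('X_[dyson_target setT a] : {mpoly rat[n]}) =
  \prod_i xvar i * \prod_(kl : 'I_n * 'I_n | kl.1 != kl.2) xvar kl.2 ^+ a kl.1.
Proof.
rewrite mpolyXE_id rmorph_prod /=.
rewrite -(pair_big_dep predT (fun k l => k != l) (fun k l => xvar l ^+ a k)) /=.
rewrite (exchange_big_dep predT) //= -big_split /=; apply: eq_bigr => l _.
rewrite rmorphXn /= dyson_target_at ?inE // exprS expr_sum; congr (_ * _).
by apply: eq_bigl => k; rewrite !inE andbT.
Qed.

Theorem theorem1p7
  (n : nat) (hn : (1 <= n)%N)
  (a : 'I_n.+1 -> nat)
  (m nu : nat) (hm : (0 < m)%N)
  (i : 'I_m -> 'I_n.+1) (j : 'I_nu -> 'I_n.+1)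
  (hi_first : i (Ordinal hm) = ord0)
  (hi_incr : forall r s : 'I_m, (r < s)%N -> (i r < i s)%N)
  (hi_lt : forall r : 'I_m, (i r < n)%N)
  (hj_pos : forall s : 'I_nu, (0 < j s)%N)
  (hj_incr : forall r s : 'I_nu, (r < s)%N -> (j r < j s)%N)
  (hij : forall (r : 'I_m) (s : 'I_nu), i r != j s)
  (p : 'I_nu -> nat)
  (hp_pos : forall s : 'I_nu, (0 < p s)%N)
  (hp_sum : (\sum_(s < nu) p s)%N = m) :
  let x := @xvar n.+1 in
  let asum := (\sum_(k : 'I_n.+1 | k != ord0) a k)%N in
  let I0 := [set i r | r : 'I_m] in
  let sigma := fun T : {set 'I_n.+1} => (\sum_(t in T) a t)%N in
  CT ((\prod_(s < nu) x (j s) ^+ p s) / (\prod_(r < m) x (i r)) *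
      \prod_(kl : 'I_n.+1 * 'I_n.+1 | kl.1 != kl.2)
        (1 - x kl.1 / x kl.2) ^+ a kl.1)
  = ((\sum_(k < n.+1) a k)%N`!)%:R / (\prod_(k < n.+1) (a k)`!)%N%:R *
    \sum_(T : {set 'I_n.+1} | (T \subset I0) && (T != set0))
      (-1) ^+ #|T| *
      ((sigma T)%:R / (1 + asum%:R + (a ord0)%:R - (sigma T)%:R)).
Proof.
move=> x asum I0 sigma.
have i_inj : injective i.
  move=> r s irs; apply/val_inj => /=.
  by case: (ltngtP r s) => // /hi_incr; rewrite irs ltnn.
have cardI0 : #|I0| = m by rewrite card_imset // card_ord.
have jI0 s : j s \notin I0.
  by apply/imsetP => -[r _ /esym/eqP]; apply/negP; exact: hij.
(* The missing variables are multiplied in, so that 1 / prod_(i in I0) x_i becomes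
   1 / prod_i x_i. *)
pose g : {mpoly rat[n.+1]} :=
  \prod_(s < nu) 'X_(j s) ^+ p s * \prod_(l in ~: I0) 'X_l.
have gE : g \is #|[set: 'I_n.+1]|.-homog.
  rewrite cardsT -(cardsC I0) cardI0 -hp_sum -sum1_card.
  apply: dhomogM; apply: (big_ind2 (fun (q : {mpoly rat[n.+1]}) d => q \is d.-homog)).
  - exact: dhomog1.
  - by move=> q d q' e; exact: dhomogM.
  - by move=> s _; rewrite -{2}[p s]mul1n; apply: dhomogMn; rewrite dhomogX /= mdeg1.
  - exact: dhomog1.
  - by move=> q d q' e; exact: dhomogM.
  - by move=> l _; rewrite dhomogX /= mdeg1.
have x0 k : x k != 0.
  rewrite /x /xvar tofrac_eq0; apply/eqP => /(congr1 (mcoeff U_(k))).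
  by rewrite mcoeffXU eqxx mcoeff0 => /eqP; rewrite oner_eq0.
have cancelXQ (F : fieldType) (P XI XJ D Q : F) : XI != 0 -> XJ != 0 -> Q != 0 ->
    P / XI * D = P * XJ * (D * Q) / (XI * XJ * Q).
  by move=> XI0 XJ0 Q0; field; rewrite XI0 XJ0 Q0.
transitivity ((g * dyson setT a)@_(dyson_target setT a)).
  rewrite -CT_eq; congr CT.
  rewrite tofrac_dyson_target rmorphM /= tofrac_dyson rmorphM !rmorph_prod /=.
  under [X in _ = X * _ * _ / _]eq_bigr do rewrite rmorphXn.
  have -> : \prod_l xvar l = \prod_(r < m) x (i r) * \prod_(l in ~: I0) x l.
    rewrite (bigID (mem I0)) /= big_imset //=; last by move=> ? ? _ _; exact: i_inj.
    by congr (_ * _); apply: eq_bigl => l; rewrite inE.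
  rewrite -/x; set XI := \prod_(r < m) _; set XJ := \prod_(l in _) _.
  set P := \prod_(s < nu) _; set D := \prod_(kl | _) (1 - _) ^+ _.
  set Q := \prod_(kl | _) x _ ^+ _.
  have XI0 : XI != 0 by apply/prodf_neq0 => r _; exact: x0.
  have XJ0 : XJ != 0 by apply/prodf_neq0 => l _; exact: x0.
  have Q0 : Q != 0 by apply/prodf_neq0 => kl _; exact/expf_neq0/x0.
  exact (cancelXQ _ P XI XJ D Q XI0 XJ0 Q0).
rewrite mcoeff_dyson //.
have evalE (T : {set 'I_n.+1}) : g.@[indic rat (setT :\: T)] = (T \subset I0)%:R.
  rewrite setTD mevalM !rmorph_prod /=.
  have [TI0 | /subsetPn[l lT lI0]] := boolP (T \subset I0).
    rewrite !big1 ?mulr1 // => [l | s _].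
      rewrite mevalXU /indic !inE => lI0.
      rewrite (contraNN _ lI0) //; exact: (subsetP TI0).
    rewrite rmorphXn /= mevalXU /indic inE (contraNN _ (jI0 s)) ?expr1n //.
    exact: (subsetP TI0).
  by rewrite (bigD1 (l : 'I_n.+1)) ?inE //= mevalXU /indic inE lT mul0r mulr0.
pose A := (\sum_(k < n.+1) a k)%N.
pose C : rat := A`!%:R / (\prod_(k < n.+1) (a k)`!)%N%:R.
have weightE (T : {set 'I_n.+1}) : dyson_weight setT a T =
    C * (1 + (sigma T)%:R / (1 + asum%:R + (a ord0)%:R - (sigma T)%:R)).
  set N := (\sum_(k in setT :\: T) a k)%N.
  have AE : A = (sigma T + N)%N.
    rewrite /A (bigID (mem T)) /=; congr (_ + _)%N.
    by apply: eq_bigl => k; rewrite !inE andbT.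
  have aE : A = (asum + a ord0)%N by rewrite /A (bigD1 ord0) //= addnC.
  have -> : 1 + asum%:R + (a ord0)%:R - (sigma T)%:R = N.+1%:R :> rat.
    by rewrite -(addrA 1) -natrD -aE AE natrD -natr1; ring.
  have sumT : (\sum_(k in setT) a k = A)%N by apply: eq_bigl => k; rewrite inE.
  have prodT : (\prod_(k in setT) (a k)`! = \prod_(k < n.+1) (a k)`!)%N.
    by apply: eq_bigl => k; rewrite inE.
  rewrite /dyson_weight -/N sumT prodT /C factS natrM AE -addnS natrD -AE.
  have N0 : N.+1%:R != 0 :> rat by rewrite pnatr_eq0.
  have f0 : (\prod_(k < n.+1) (a k)`!)%N%:R != 0 :> rat.
    by rewrite pnatr_eq0 -lt0n prodn_gt0 // => k; rewrite fact_gt0.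
  by move: (N.+1%:R) N0 => z z0; field; rewrite z0 f0.
have signs0 : \sum_(T : {set 'I_n.+1} | T \subset I0) (-1) ^+ #|T| = 0 :> rat.
  have := @alt_sum_subsets_eq0 rat _ I0 1; rewrite msize1 cardI0 => /(_ hm) sum0.
  by apply: etrans sum0; apply: eq_bigr => T _; rewrite meval1 mulr1.
transitivity (\sum_(T : {set 'I_n.+1} | T \subset I0)
    (C * (-1) ^+ #|T| + C * ((-1) ^+ #|T| *
    ((sigma T)%:R / (1 + asum%:R + (a ord0)%:R - (sigma T)%:R))))).
  rewrite [RHS]big_mkcond /= big_mkcond /=; apply: eq_bigr => T _.
  rewrite subsetT evalE weightE; case: (T \subset I0); last by rewrite mulr0.
  by rewrite mulr1; ring.
rewrite big_split -!mulr_sumr /= signs0 mulr0 add0r; congr (_ * _).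
rewrite (bigD1 set0) ?sub0set //=.
by rewrite {1}/sigma big_set0 mul0r mulr0 add0r.
Qed.
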